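(* Let $\mathscr{D}=\{\delta(n): n\in\mathbb{N}, n\ge 1\}\subseteq[0,\infty)$ be the defect set. Then $\mathscr{D}$ is a well-ordered subset of $\mathbb{R}$ (with its usual order) of order type $\omega^\omega$. Furthermore, for every integer $k\ge 1$, the set $\mathscr{D}\cap[0,k)$ has order type $\omega^k$.
   Context: For a positive integer $n$, its complexity $\|n\|$ is the smallest number of $1$'s needed to write $n$ using only the number $1$, addition, multiplication and parentheses (in any legal nesting). The defect of $n$ is $\delta(n)=\|n\|-3\log_3 n$; it is always $\ge 0$. *)

(* Defs.v *)
From HB Require Import structures.
From mathcomp Require Import all_boot all_order all_algebra.
From mathcomp Require Import finmap.
From mathcomp Require Import all_classical all_reals all_analysis.
From mathcomp Require Export wochoice.

Set Implicit Arguments.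
Unset Strict Implicit.
Unset Printing Implicit Defensive.

Import Order.TTheory GRing.Theory Num.Theory.

Local Open Scope classical_set_scope.
Local Open Scope ring_scope.

Inductive expr : Type :=
  | One
  | Add of expr & expr
  | Mul of expr & expr.

Fixpoint value (e : expr) : nat :=
  match e with
  | One => 1
  | Add e1 e2 => (value e1 + value e2)%N
  | Mul e1 e2 => (value e1 * value e2)%N
  end.

Fixpoint ones (e : expr) : nat :=
  match e with
  | One => 1
  | Add e1 e2 => (ones e1 + ones e2)%N
  | Mul e1 e2 => (ones e1 + ones e2)%N
  end.

Definition writable (n c : nat) : bool :=
  `[< exists e, value e = n /\ ones e = c >].

Fact writable_ex (n : nat) : exists c, writable n.+1 c.
Proof.
elim: n => [|n [c /asboolP[e [ve oe]]]].
  by exists 1%N; apply/asboolP; exists One.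
by exists c.+1; apply/asboolP; exists (Add One e); rewrite /= ve oe.
Qed.

(* No expression has value 0; complexity 0 is a junk value. *)
Definition complexity (n : nat) : nat :=
  if n is m.+1 then ex_minn (writable_ex m) else 0%N.

Definition defect (R : realType) (n : nat) : R :=
  (complexity n)%:R - 3 * (ln n%:R / ln 3).

Definition defect_set (R : realType) : set R :=
  [set defect R n | n in [set n : nat | (1 <= n)%N]].

Arguments defect_set : clear implicits.

(* Ordinal exponentiation: for a well-order B of type beta, omega ^ beta is   *)
(* the order type of the finitely supported functions from B to omega,        *)
(* compared at the largest argument where they differ. An element f stands    *)
(* for the Cantor normal form \sum_b omega ^ b * f b.                         *)
Definition omega_pow (d : Order.disp_t) (B : orderType d) : Type :=
  {fsfun B -> nat with 0%N}.

Definition omega_pow_lt (d : Order.disp_t) (B : orderType d)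
    (f g : omega_pow B) : Prop :=
  exists b : B, (f b < g b)%N /\ forall c : B, (b < c)%O -> f c = g c.

Definition has_order_type (R : realType) (A : set R)
    (W : Type) (ltW : W -> W -> Prop) : Prop :=
  exists h : W -> R,
    set_bij [set: W] A h /\ forall u v : W, ltW u v <-> h u < h v.

(* Main.v *)
Require Import Defs.
From HB Require Import structures.
From mathcomp Require Import all_boot all_order all_algebra.
From mathcomp Require Import finmap zify ring lra.
From mathcomp Require Import all_classical all_reals all_analysis.

Import Order.TTheory GRing.Theory Num.Theory.

Local Open Scope classical_set_scope.
Local Open Scope ring_scope.

(**
Write d for the defect and D for the set of defects.  A number that is not
divisible by 3 at full efficiency is optimally 1, a product of two numbers whose
defects are bounded away from 0, or a sum a + b with b <= a.  In a sum of bounded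
defect b takes finitely many values and
  d (a + b) = d a + ||b|| - 3 log_3 (1 + b / a),
so that as a tends to infinity d (a + b) approaches lim d a + ||b|| from below.
By induction on the size of the defect, every bounded family of defects converges
along an ultrafilter, from below, to a limit y which is either attained or such
that y - 1 lies in the closure of D + N.  Hence D is well-ordered.

Conversely 1 + d n is a limit point of D, approached by the d (3 ^ k n + 1).
Therefore the limit points of D are exactly the translates by 1 of the elements of
its closure.  For t an isolated element of D, the elements of D below 1 + t that
lie above all 1 + s with s < t form a sequence of type omega with limit 1 + t.
Thus D is partitioned into copies of omega indexed by the isolated elements of D,
which lie one unit lower; iterating, the indices give the coefficients of the
Cantor normal form.
*)

(** * Integer complexity *)

Lemma value_gt0 (e : expr) : (0 < value e)%N.
Proof. by elim: e => //= a ha b hb; rewrite ?addn_gt0 ?muln_gt0 ha ?hb. Qed.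

Lemma ones_gt0 (e : expr) : (0 < ones e)%N.
Proof. by elim: e => //= a ha b hb; rewrite addn_gt0 ha. Qed.

Lemma complexity_le (e : expr) : (complexity (value e) <= ones e)%N.
Proof.
case E : (value e) => [|m] //=; case: ex_minnP => c _ min_c; apply: min_c.
by apply/asboolP; exists e.
Qed.

Lemma complexity_ex (n : nat) : (0 < n)%N ->
  exists e, value e = n /\ ones e = complexity n.
Proof. by case: n => // m _ /=; case: ex_minnP => c /asboolP. Qed.

Lemma complexity_gt0 (n : nat) : (0 < n)%N -> (0 < complexity n)%N.
Proof. by move=> /complexity_ex[e [_ <-]]; exact: ones_gt0. Qed.

Lemma complexity1 : complexity 1 = 1%N.
Proof.
by apply/eqP; rewrite eqn_leq complexity_gt0 // andbT; exact: (complexity_le One).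
Qed.

Lemma complexityD (m n : nat) : (0 < m)%N -> (0 < n)%N ->
  (complexity (m + n) <= complexity m + complexity n)%N.
Proof.
move=> /complexity_ex[e [<- <-]] /complexity_ex[f [<- <-]].
exact: (complexity_le (Add e f)).
Qed.

Lemma complexityM (m n : nat) : (0 < m)%N -> (0 < n)%N ->
  (complexity (m * n) <= complexity m + complexity n)%N.
Proof.
move=> /complexity_ex[e [<- <-]] /complexity_ex[f [<- <-]].
exact: (complexity_le (Mul e f)).
Qed.

Lemma complexity3_le : (complexity 3 <= 3)%N.
Proof. exact: (complexity_le (Add One (Add One One))). Qed.

Lemma complexity_exp3M (j n : nat) : (0 < n)%N ->
  (complexity (3 ^ j * n) <= 3 * j + complexity n)%N.
Proof.
move=> n0; elim: j => [|j IH]; first by rewrite mul1n.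
rewrite expnS -mulnA; apply: leq_trans (complexityM _ _ _ _) _ => //.
  by rewrite muln_gt0 expn_gt0.
by have := complexity3_le; lia.
Qed.

(** The outermost operation of an optimal expression: its arguments are optimal too, and a factor 1
    would waste a one. *)
Lemma complexity_split (n : nat) : (0 < n)%N ->
  [\/ n = 1%N,
      exists a b, [/\ (0 < b)%N, (b <= a)%N, n = (a + b)%N
                    & complexity n = (complexity a + complexity b)%N]
    | exists a b, [/\ (1 < a)%N, (1 < b)%N, n = (a * b)%N
                    & complexity n = (complexity a + complexity b)%N]].
Proof.
move=> n0; have [[|e f|e f] /= [vE oE]] := complexity_ex _ n0.
- by constructor 1.
- constructor 2; have e0 := value_gt0 e; have f0 := value_gt0 f.
  have cE : complexity n = (complexity (value e) + complexity (value f))%N.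
    have := complexity_le e; have := complexity_le f.
    by have := complexityD _ _ e0 f0; rewrite vE -oE; lia.
  have [le_fe|/ltnW le_ef] := leqP (value f) (value e).
    by exists (value e), (value f).
  by exists (value f), (value e); split=> //; rewrite addnC.
- constructor 3; have e0 := value_gt0 e; have f0 := value_gt0 f.
  have cE : complexity n = (complexity (value e) + complexity (value f))%N.
    have := complexity_le e; have := complexity_le f.
    by have := complexityM _ _ e0 f0; rewrite vE -oE; lia.
  exists (value e), (value f); split => //.
    rewrite ltn_neqAle e0 andbT; apply/eqP => e1.
    by move: vE cE; rewrite -e1 mul1n => ->; rewrite complexity1; lia.
  rewrite ltn_neqAle f0 andbT; apply/eqP => f1.
  by move: vE cE; rewrite -f1 muln1 => ->; rewrite complexity1; lia.
Qed.

(** Except at [a = b = 2], even [6 * (a + b) <= 5 * (a * b)] holds, and the cube of 5/6 is below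
    8/9. *)
Lemma cube_addn_bounds (a b : nat) : (1 < a)%N -> (1 < b)%N ->
  ((a + b) ^ 3 <= (a * b) ^ 3)%N /\
  ((a == 2) && (b == 2) \/ (9 * (a + b) ^ 3 <= 8 * (a * b) ^ 3)%N).
Proof.
move=> a1 b1; split; first by rewrite leq_exp2r //; nia.
have aux (x y : nat) : (6 ^ 3 * x <= 5 ^ 3 * y -> 9 * x <= 8 * y)%N by lia.
have [|ab2] := boolP ((a == 2) && (b == 2)); [by left|right].
have : ((6 * (a + b)) ^ 3 <= (5 * (a * b)) ^ 3)%N by rewrite leq_exp2r //; nia.
by rewrite (expnMn 6) (expnMn 5); exact: aux.
Qed.

(* Selfridge's bound, together with the spectral gap above the powers of 3. *)
Lemma cube_value_le (e : expr) : (value e ^ 3 <= 3 ^ ones e)%N /\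
  ((exists k, value e = 3 ^ k)%N \/ (9 * value e ^ 3 <= 8 * 3 ^ ones e)%N).
Proof.
(* A summand 1 is treated apart, because there the sum exceeds the product. For [b >= 3] one has
   [(1 + 1 / b) ^ 3 <= 64 / 27 < 8 / 3], and the missing factor 3 is supplied by [3 ^ p]. *)
have add1 (a b p q : nat) : a = 1%N -> (0 < b)%N -> (0 < p)%N -> (0 < q)%N ->
    (b ^ 3 <= 3 ^ q)%N -> ((a + b) ^ 3 <= 3 ^ (p + q))%N /\
    ((exists k, a + b = 3 ^ k)%N \/ (9 * (a + b) ^ 3 <= 8 * 3 ^ (p + q))%N).
  move=> -> b0 p0 q0 bq.
  have p3 : (3 <= 3 ^ p)%N by rewrite -{1}(expn1 3) leq_exp2l.
  have q3 : (3 <= 3 ^ q)%N by rewrite -{1}(expn1 3) leq_exp2l.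
  rewrite expnD.
  case: b b0 bq => [//|[|[|b]]] _ bq.
  - by split; [nia|right; nia].
  - case: q q0 q3 bq => [//|[|q]] _ q3 bq; first by lia.
    have q9 : (9 <= 3 ^ q.+2)%N by rewrite -[9%N]/(3 ^ 2)%N leq_exp2l.
    by split; [nia|left; exists 1%N].
  - set B := (3 ^ q)%N in bq *; set A := (3 ^ p)%N in p3 *.
    have h : (9 * (1 + b.+3) ^ 3 <= 24 * b.+3 ^ 3)%N by rewrite !expnS !expn0; nia.
    have h2 : (3 * b.+3 ^ 3 <= A * B)%N by apply: leq_mul.
    by split; [lia|right; lia].
elim: e => [|e [he ge] f [hf gf]|e [he ge] f [hf gf]] /=.
- by split=> //; left; exists 0%N.
- have e0 := value_gt0 e; have f0 := value_gt0 f.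
  have p0 := ones_gt0 e; have q0 := ones_gt0 f.
  have [e1|e1] := eqVneq (value e) 1%N; first exact: add1.
  have [f1|f1] := eqVneq (value f) 1%N.
    by rewrite addnC (addnC (ones e)); exact: add1.
  have [||h1 h2] := cube_addn_bounds (value e) (value f); [lia|lia|].
  have h3 : ((value e * value f) ^ 3 <= 3 ^ (ones e + ones f))%N.
    by rewrite expnMn expnD leq_mul.
  split; first exact: leq_trans h3.
  right; case: h2 => [/andP[/eqP ae /eqP bf]|]; last first.
    by move=> /leq_trans; apply; rewrite leq_mul2l h3.
  (* For 2 + 2, powers of 3 that are at least 8 are at least 9, and [9 * 4 ^ 3 <= 8 * 9 * 9]. *)
  rewrite ae bf expnD; rewrite ae in he; rewrite bf in hf.
  have two q : (2 ^ 3 <= 3 ^ q)%N -> (9 <= 3 ^ q)%N.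
    by case: q => [|[|q]] // _; rewrite -[9%N]/(3 ^ 2)%N leq_exp2l.
  by have := two _ he; have := two _ hf; nia.
- rewrite expnD expnMn; split; first exact: leq_mul.
  case: ge => [[k ek]|ge]; last by right; nia.
  case: gf => [[l fl]|gf]; last by right; nia.
  by left; exists (k + l)%N; rewrite ek fl expnD.
Qed.

Lemma cube_le_exp3 (n : nat) : (0 < n)%N -> (n ^ 3 <= 3 ^ complexity n)%N.
Proof. by move=> /complexity_ex[e [<- <-]]; case: (cube_value_le e). Qed.

Lemma cube_gap (n : nat) : (0 < n)%N ->
  (exists k, n = 3 ^ k)%N \/ (9 * n ^ 3 <= 8 * 3 ^ complexity n)%N.
Proof. by move=> /complexity_ex[e [<- <-]]; case: (cube_value_le e). Qed.

(** Excludes a factor 3 that costs exactly three ones; removing such a factor does not change the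
    defect. *)
Definition reduced (n : nat) : Prop :=
  forall m, n = (3 * m)%N -> complexity n != (complexity m + 3)%N.

(** Were [a] a power of 3, one factor 3 could be split off the whole product at a cost of exactly
    three ones; so [a] falls under the other case of [cube_gap]. *)
Lemma reduced_factor (a b : nat) : (1 < a)%N -> (0 < b)%N -> reduced (a * b) ->
  complexity (a * b) = (complexity a + complexity b)%N ->
  (9 * a ^ 3 <= 8 * 3 ^ complexity a)%N.
Proof.
move=> a1 b0 red cE; have a0 : (0 < a)%N by exact: ltnW.
have [[[|k] ak]|//] := cube_gap _ a0; first by move: a1; rewrite ak.
have := cube_le_exp3 _ a0; rewrite {1}ak -expnM leq_exp2l // => ck.
have abE : (a * b = 3 * (3 ^ k * b))%N by rewrite ak expnS mulnA.
have /eqP[] := red _ abE.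
have := complexity_exp3M k _ b0.
have kb0 : (0 < 3 ^ k * b)%N by rewrite muln_gt0 expn_gt0.
by have := complexity_exp3M 1 _ kb0; rewrite expn1 -abE; lia.
Qed.

(** * Defects *)

Section Defect.
Context (R : realType).
Local Notation d := (defect R).

Lemma ln3_gt0 : 0 < ln 3 :> R.
Proof. by apply: ln_gt0; lra. Qed.

(* [3 * log_3 ((a + b) / a)] *)
Definition log3r (a b : nat) : R := 3 * (ln (1 + b%:R / a%:R) / ln 3).

(** The last term counts the ones saved over multiplying optimal expressions, so a sum of two
    defects is a defect plus a natural number. *)
Lemma defectM (m n : nat) : (0 < m)%N -> (0 < n)%N ->
  d m + d n = d (m * n) + (complexity m + complexity n - complexity (m * n))%:R.
Proof.
move=> m0 n0; rewrite /defect natrB ?complexityM // natrD natrM.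
by rewrite lnM ?posrE ?ltr0n //; field; rewrite gt_eqF // ln3_gt0.
Qed.

Lemma defectM_eq (m n : nat) : (0 < m)%N -> (0 < n)%N ->
  complexity (m * n) = (complexity m + complexity n)%N -> d (m * n) = d m + d n.
Proof. by move=> m0 n0 E; rewrite defectM // E subnn addr0. Qed.

Lemma defectD (a b : nat) : (0 < a)%N ->
  d (a + b) = d a + (complexity (a + b))%:R - (complexity a)%:R - log3r a b.
Proof.
move=> a0; have a0' : 0 < a%:R :> R by rewrite ltr0n.
rewrite /defect /log3r.
have -> : (a + b)%:R = a%:R * (1 + b%:R / a%:R) :> R.
  by rewrite natrD; field; rewrite gt_eqF.
rewrite lnM ?posrE // ?ltr_pwDl ?divr_ge0 //.
by field; rewrite gt_eqF // ln3_gt0.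
Qed.

Lemma log3r_gt0 (a b : nat) : (0 < a)%N -> (0 < b)%N -> 0 < log3r a b.
Proof.
move=> a0 b0; rewrite mulr_gt0 // divr_gt0 ?ln3_gt0 // ln_gt0 //.
by rewrite ltrDl divr_gt0 ?ltr0n.
Qed.

Lemma log3r_le3 (a b : nat) : (0 < a)%N -> (b <= a)%N -> log3r a b <= 3.
Proof.
move=> a0 ba; rewrite /log3r -[leRHS]mulr1 ler_pM2l // ler_pdivrMr ?ln3_gt0 // mul1r.
have ab : b%:R / a%:R <= 1 :> R by rewrite ler_pdivrMr ?ltr0n // mul1r ler_nat.
have ab0 : 0 <= b%:R / a%:R :> R by rewrite divr_ge0.
by rewrite ler_ln ?posrE; lra.
Qed.

Lemma log3r_small (b : nat) (e : R) : 0 < e ->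
  exists N, forall a, (N < a)%N -> log3r a b < e.
Proof.
move=> e0; have l3 := ln3_gt0.
exists (Num.truncn (3 * b%:R / (e * ln 3))) => a Na.
have a0 : 0 < a%:R :> R by rewrite ltr0n (leq_ltn_trans _ Na).
have h : 3 * b%:R / (e * ln 3) < a%:R.
  apply: lt_le_trans (truncnS_gt _) _; last by rewrite ler_nat.
rewrite /log3r; apply: (@le_lt_trans _ _ (3 * (b%:R / a%:R / ln 3))).
  rewrite ler_pM2l // ler_pM2r ?invr_gt0 //; apply: le_ln1Dx.
  by apply: lt_le_trans (_ : 0 <= _); [lra|rewrite divr_ge0].
rewrite ltr_pdivrMr ?mulr_gt0 // in h.
have -> : 3 * (b%:R / a%:R / ln 3) = 3 * b%:R / (a%:R * ln 3) :> R.
  by field; rewrite !gt_eqF.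
by rewrite ltr_pdivrMr ?mulr_gt0 // mulrCA.
Qed.

Lemma defect_ge (n : nat) (x : R) : (0 < n)%N -> 0 < x ->
  x * n%:R ^+ 3 <= 3 ^+ complexity n -> ln x / ln 3 <= d n.
Proof.
move=> n0 x0 h; have n0' : 0 < n%:R :> R by rewrite ltr0n.
have : ln (x * n%:R ^+ 3) <= ln (3 ^+ complexity n).
  by rewrite ler_ln // posrE ?mulr_gt0 ?exprn_gt0.
rewrite lnM ?posrE ?exprn_gt0 // !lnXn // => le.
rewrite /defect ler_pdivrMr ?ln3_gt0 // mulrBl -mulrA mulfVK ?gt_eqF ?ln3_gt0 //.
by move: le; rewrite -[ln n%:R *+ 3]mulr_natl -[ln 3 *+ complexity n]mulr_natl; lra.
Qed.

Lemma defect_ge0 (n : nat) : (0 < n)%N -> 0 <= d n.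
Proof.
move=> n0; have := @defect_ge n 1 n0 ltr01; rewrite ln1 mul0r; apply.
by rewrite mul1r -!natrX ler_nat cube_le_exp3.
Qed.

(** The base-3 logarithm of the factor 9/8 in [cube_gap]. *)
Definition gap : R := ln (9 / 8) / ln 3.

Lemma gap_gt0 : 0 < gap.
Proof. by rewrite divr_gt0 ?ln3_gt0 // ln_gt0 //; lra. Qed.

Lemma defect_ge_gap (n : nat) : (0 < n)%N ->
  (9 * n ^ 3 <= 8 * 3 ^ complexity n)%N -> gap <= d n.
Proof.
move=> n0 h; apply: defect_ge => //.
move: h; rewrite -(ler_nat R) !natrM !natrX; lra.
Qed.

Lemma defect1 : d 1 = 1.
Proof. by rewrite /defect complexity1 ln1 mul0r mulr0 subr0. Qed.

Lemma defect3 : d 3 = 0.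
Proof.
apply/eqP; rewrite eq_le defect_ge0 // andbT /defect divff ?gt_eqF ?ln3_gt0 //.
by rewrite mulr1 subr_le0 (ler_nat R _ 3) complexity3_le.
Qed.

Lemma reduced_ex (n : nat) : (0 < n)%N ->
  exists m, [/\ (0 < m)%N, reduced m & d m = d n].
Proof.
elim/ltn_ind: n => n IH n0; have [|nred] := pselect (reduced n).
  by move=> red; exists n.
have [m [nE cE]] : exists m, n = (3 * m)%N /\ complexity n = (complexity m + 3)%N.
  apply: contra_notP nred => /forallNP h m nE; apply/eqP => cE.
  by apply: (h m).
have m0 : (0 < m)%N by lia.
have [|//|k [k0 kred kE]] := IH m; first by lia.
exists k; split=> //; rewrite kE nE.
(* The lower bound comes from [complexity m + 3 = complexity n <= complexity 3 + complexity m]. *)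
have c3 : complexity 3 = 3%N.
  have := complexityM 3 m erefl m0; have := complexity3_le.
  by rewrite -nE cE; lia.
by rewrite defectM_eq // ?defect3 ?add0r // -nE cE c3 addnC.
Qed.

(** * Limits of defects along an ultrafilter *)

(* The closure (from below) of the additive semigroup generated by the defects
   and 1. *)
Definition semigroup_closure : set R := [set y | forall e, 0 < e ->
  exists n j, (0 < n)%N /\ y - e < d n + j%:R <= y].

(** By [defectM], the sum of two approximants is again a defect plus a natural number. *)
Lemma semigroup_closureD (x y : R) :
  semigroup_closure x -> semigroup_closure y -> semigroup_closure (x + y).
Proof.
move=> hx hy e e0; have e2 : 0 < e / 2 by lra.
have [m [i [m0 mi]]] := hx _ e2; have [n [j [n0 nj]]] := hy _ e2.
exists (m * n)%N, (complexity m + complexity n - complexity (m * n) + (i + j))%N.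
split; first by rewrite muln_gt0 m0.
by have := defectM _ _ m0 n0; rewrite !natrD; lra.
Qed.

Lemma semigroup_closure_nat (j : nat) : semigroup_closure j%:R.
Proof. by move=> e e0; exists 3%N, j; split=> //; rewrite defect3; lra. Qed.

Section Ultra.
Context (U : set_system nat) (UU : UltraFilter U).

Definition ultra_below (f : nat -> R) (y : R) : Prop :=
  forall e, 0 < e -> U [set t | y - e < f t <= y].

(** The shift by 1 in the second case is what later places limit points one unit above adherent
    points. *)
Definition ultra_good (f : nat -> R) : Prop :=
  exists y, ultra_below f y /\ (U [set t | f t = y] \/ semigroup_closure (y - 1)).

Lemma ultra_bounded_const (g : nat -> nat) (N : nat) :
  U [set t | (g t <= N)%N] -> exists c, U [set t | g t = c].
Proof.
elim: N => [|N IH] UN.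
  by exists 0%N; apply: filterS UN => t /=; rewrite leqn0 => /eqP.
have [|nU] := in_ultra_setVsetC [set t | g t = N.+1] UU; first by exists N.+1.
by apply: IH; apply: filterS2 UN nU => t /=; lia.
Qed.

Lemma ultra_good_eq (f g : nat -> R) :
  U [set t | f t = g t] -> ultra_good f -> ultra_good g.
Proof.
move=> fg [y [fy hy]]; exists y; split.
  by move=> e e0; apply: filterS2 fg (fy _ e0) => t /= ->.
by case: hy => [hy|]; [left; apply: filterS2 fg hy => t /= ->|right].
Qed.

Lemma ultra_good_cst (f : nat -> R) (y : R) :
  U [set t | f t = y] -> ultra_good f.
Proof.
move=> fy; exists y; split; last by left.
by move=> e e0; apply: filterS fy => t /= ->; lra.
Qed.

Lemma ultra_below_closure (u : nat -> nat) (y : R) :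
  U [set t | (0 < u t)%N] -> ultra_below (d \o u) y -> semigroup_closure y.
Proof.
move=> u0 uy e e0; have [t [/= ut yt]] := filter_ex (filterI u0 (uy _ e0)).
by exists (u t), 0%N; rewrite addr0.
Qed.

(** If both limits are attained, so is their sum; otherwise a limit that is not attained supplies
    the unit, and the other one lies in the semigroup closure. *)
Lemma ultra_goodD (u v : nat -> nat) :
  U [set t | (0 < u t)%N] -> U [set t | (0 < v t)%N] ->
  ultra_good (d \o u) -> ultra_good (d \o v) ->
  ultra_good (fun t => d (u t) + d (v t)).
Proof.
move=> u0 v0 [x [ux hx]] [y [vy hy]]; exists (x + y); split.
  move=> e e0; have e2 : 0 < e / 2 by lra.
  by apply: filterS2 (ux _ e2) (vy _ e2) => t /=; lra.
have Xx := ultra_below_closure _ _ u0 ux; have Xy := ultra_below_closure _ _ v0 vy.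
case: hx hy => [hx [hy|hy]|hx _].
- by left; apply: filterS2 hx hy => t /= -> ->.
- by right; rewrite -addrA; exact: semigroup_closureD.
- by right; rewrite addrAC; exact: semigroup_closureD.
Qed.

(** The logarithm is positive and tends to 0, so the limit is [y + c], reached from below; as
    [c >= 1], lowering it by 1 leaves [y] plus a natural number. *)
Lemma ultra_good_addn (a : nat -> nat) (b c : nat) : (0 < b)%N -> (0 < c)%N ->
  (forall N, U [set t | (N < a t)%N]) -> ultra_good (d \o a) ->
  ultra_good (fun t => d (a t) + c%:R - log3r (a t) b).
Proof.
move=> b0 c0 aoo [y [ay _]]; exists (y + c%:R); split.
  move=> e e0; have e2 : 0 < e / 2 by lra.
  have [N hN] := log3r_small b _ e2.
  apply: filterS3 (aoo N) (aoo 0%N) (ay _ e2) => t /= /hN aN a0.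
  by have := log3r_gt0 _ _ a0 b0; lra.
right; have -> : y + c%:R - 1 = y + c.-1%:R.
  by rewrite -{1}(prednK c0) -natr1; ring.
apply: semigroup_closureD; first exact: ultra_below_closure (aoo 0%N) ay.
exact: semigroup_closure_nat.
Qed.

(** The 1/2 serves sums [a + b] with [a] large: [complexity b] is at least 1 and the logarithm is
    below 1/2. *)
Definition step : R := Num.min gap (1 / 2).

Lemma step_gt0 : 0 < step.
Proof. by rewrite lt_min gap_gt0; lra. Qed.

(* The number of steps drops along an optimal representation: each factor of a
   reduced product loses at least [gap], while in a sum [a + b] with [b] bounded
   and [a] large, [a] loses about the complexity of [b]. *)
Lemma ultra_good_steps (k : nat) (u : nat -> nat) :
  U [set t | (0 < u t)%N] -> U [set t | d (u t) < k%:R * step] ->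
  ultra_good (d \o u).
Proof.
have s0 := step_gt0; have [sg s2] : step <= gap /\ step <= 1 / 2.
  by rewrite /step !ge_min !lexx orbT.
elim: k u => [|k IH] u0 Uu0 Uuk.
  have [t [/= ut]] := filter_ex (filterI Uu0 Uuk).
  by have := defect_ge0 _ ut; lra.
have /choice[core coreP] : forall n, exists m, (0 < n)%N ->
    [/\ (0 < m)%N, reduced m & d m = d n].
  move=> [|n]; first by exists 0%N.
  by have [m hm] := reduced_ex n.+1 erefl; exists m.
pose u t := core (u0 t).
apply: (@ultra_good_eq (d \o u)).
  by apply: filterS Uu0 => t /= /coreP[].
have {}Uuk : U [set t | d (u t) < k.+1%:R * step].
  by apply: filterS2 Uu0 Uuk => t /= /coreP[_ _ ->].
have Uu : U [set t | (0 < u t)%N /\ reduced (u t)].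
  by apply: filterS Uu0 => t /= /coreP[].
have {Uu0} Uu0 : U [set t | (0 < u t)%N] by apply: filterS Uu => t [].
move: u Uuk Uu Uu0 => {u0 core coreP} u Uuk Uu Uu0.
have [U1|U1] := in_ultra_setVsetC [set t | u t = 1%N] UU.
  by apply: (@ultra_good_cst _ 1); apply: filterS U1 => t /= ->; exact: defect1.
pose isum t (p : nat * nat) := [/\ (0 < p.2)%N, (p.2 <= p.1)%N,
  u t = (p.1 + p.2)%N & complexity (u t) = (complexity p.1 + complexity p.2)%N].
(* The ultrafilter settles whether almost all terms split as sums or as products; products come
   first. *)
have [US|US] := in_ultra_setVsetC [set t | exists p, isum t p] UU; last first.
  pose iprod t (p : nat * nat) := [/\ (1 < p.1)%N, (1 < p.2)%N,
    u t = (p.1 * p.2)%N & complexity (u t) = (complexity p.1 + complexity p.2)%N].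
  have /choice[p pP] : forall t, exists p, (exists q, iprod t q) -> iprod t p.
    move=> t; have [[q qP]|nq] := pselect (exists q, iprod t q).
      by exists q.
    by exists (0%N, 0%N).
  have UP : U [set t | iprod t (p t)].
    apply: filterS3 U1 US Uu0 => t /= u1 us ut; apply: pP.
    have [//|[a [b h]]|[a [b h]]] := complexity_split _ ut.
      by case: us; exists (a, b).
    by exists (a, b).
  have Ud : U [set t | [/\ d (u t) = d (p t).1 + d (p t).2, gap <= d (p t).1
                       & gap <= d (p t).2]].
    apply: filterS2 UP Uu => t [/= a1 b1 uE cE] [_ red].
    have a0 := ltnW a1; have b0 := ltnW b1; rewrite uE in red cE *; split.
    - exact: defectM_eq.
    - by apply: defect_ge_gap => //; exact: reduced_factor red cE.
    - apply: defect_ge_gap => //; rewrite mulnC addnC in red cE.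
      exact: reduced_factor red cE.
  have Up1 : U [set t | (0 < (p t).1)%N] by apply: filterS UP => t [/ltnW].
  have Up2 : U [set t | (0 < (p t).2)%N] by apply: filterS UP => t [_ /ltnW].
  apply: (@ultra_good_eq (fun t => d (p t).1 + d (p t).2)).
    by apply: filterS Ud => t [].
  apply: ultra_goodD => //; apply: IH => //;
    by apply: filterS2 Ud Uuk => t [/= -> ? ?]; rewrite -natr1; lra.
have /choice[p pP] : forall t, exists p, (exists q, isum t q) -> isum t p.
  move=> t; have [[q qP]|nq] := pselect (exists q, isum t q); first by exists q.
  by exists (0%N, 0%N).
have {US pP} US : U [set t | isum t (p t)] by apply: filterS US.
have dE t : isum t (p t) -> d (u t) =
    d (p t).1 + (complexity (p t).2)%:R - log3r (p t).1 (p t).2.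
  move=> [b0 ba uE cE]; rewrite uE defectD ?(leq_trans b0 ba) //.
  by rewrite -uE cE natrD; ring.
(* The logarithm is at most 3 and [d a] is nonnegative, so a bound on [d (a + b)] bounds
   [complexity b], hence [b] itself. *)
have [b Ub] : exists b, U [set t | (p t).2 = b].
  pose M := Num.truncn (k.+1%:R * step + 3).
  apply: (@ultra_bounded_const (fun t => (p t).2) (3 ^ M)).
  apply: filterS2 US Uuk => t /= ht dk; have := dE _ ht.
  move: ht => [b0 ba uE cE] => {}dE.
  have cM : (complexity (p t).2 <= M)%N.
    have := log3r_le3 _ _ (leq_trans b0 ba) ba.
    have := defect_ge0 _ (leq_trans b0 ba) => d0 l3.
    have ks : 0 <= k.+1%:R * step by rewrite mulr_ge0 ?ltW.
    by rewrite truncn_ge_nat; lra.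
  apply: leq_trans (_ : 3 ^ complexity (p t).2 <= _)%N; last by rewrite leq_exp2l.
  apply: leq_trans (cube_le_exp3 _ b0).
  by rewrite -{1}(expn1 (p t).2) leq_pexp2l.
(* Either [a] is constant along the ultrafilter, and with it the sum, or [a] tends to infinity. *)
have [[N UN]|/forallNP Uoo] := pselect (exists N, U [set t | ((p t).1 <= N)%N]).
  have [a Ua] := ultra_bounded_const _ _ UN.
  apply: (@ultra_good_cst _ (d (a + b))).
  by apply: filterS3 US Ua Ub => t [/= _ _ -> _] -> ->.
have {}Uoo N : U [set t | (N < (p t).1)%N].
  have [/Uoo//|] := in_ultra_setVsetC [set t | ((p t).1 <= N)%N] UU.
  by apply: filterS => t /=; lia.
have b0 : (0 < b)%N.
  by have [t [[/= h _ _ _] <-]] := filter_ex (filterI US Ub).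
apply: (@ultra_good_eq (fun t => d (p t).1 + (complexity b)%:R - log3r (p t).1 b)).
  by apply: filterS2 US Ub => t /= /dE -> ->.
apply: (@ultra_good_addn (fun t => (p t).1)) => //; first exact: complexity_gt0.
apply: IH; first exact: Uoo.
have half0 : 0 < 1 / 2 :> R by lra.
have [N hN] := log3r_small b _ half0.
have c1 : 1 <= (complexity b)%:R :> R by rewrite ler1n complexity_gt0.
have Udb : U [set t | d (u t) =
    d (p t).1 + (complexity b)%:R - log3r (p t).1 b].
  by apply: filterS2 US Ub => t /= /dE -> ->.
apply: filterS3 (Uoo N) Udb Uuk => t /= /hN hl -> ; rewrite -natr1; lra.
Qed.

Lemma ultra_good_bounded (r : R) (u : nat -> nat) :
  U [set t | (0 < u t)%N] -> U [set t | d (u t) < r] -> ultra_good (d \o u).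
Proof.
move=> u0 ur; apply: (@ultra_good_steps (Num.truncn (r / step)).+1) => //.
apply: filterS ur => t /= /lt_trans; apply.
by rewrite -ltr_pdivrMr ?step_gt0 // truncnS_gt.
Qed.

End Ultra.
End Defect.

(** * Well-ordering and limit points of the defect set *)

Section DefectSet.
Context (R : realType).
Local Notation d := (defect R).
Local Notation D := (defect_set R).

Definition limit_point : set R := [set y | forall e, 0 < e ->
  exists x, D x /\ y - e < x < y].

Definition adherent : set R := [set y | forall e, 0 < e ->
  exists x, D x /\ y - e < x <= y].

Lemma defect_set_ge0 (x : R) : D x -> 0 <= x.
Proof. by move=> [n n0 <-]; exact: defect_ge0. Qed.

Lemma defect_set0 : D 0.
Proof. by exists 3%N => //; exact: defect3. Qed.

Lemma free_ultrafilter_ex : exists U : set_system nat,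
  UltraFilter U /\ forall N, U [set t | (N <= t)%N].
Proof.
have [U [UU hU]] := @ultraFilterLemma nat \oo _.
by exists U; split=> // N; apply: hU; exact: nbhs_infty_ge.
Qed.

(** Along a free ultrafilter the limit given by [ultra_good_bounded] must be the ordinary limit
    [y]. *)
Lemma defect_seq_limit (u : nat -> nat) (y : R) : (forall t, (0 < u t)%N) ->
  (forall t, `|d (u t) - y| < t.+1%:R^-1) ->
  exists t, d (u t) <= y /\ (d (u t) = y \/ semigroup_closure R (y - 1)).
Proof.
move=> u0 uy; have [U [UU Uoo]] := free_ultrafilter_ex.
have [||z [uz hz]] := @ultra_good_bounded R U UU (y + 1) u.
- by apply: filterS (Uoo 0%N) => t _; exact: u0.
- apply: filterS (Uoo 0%N) => t _ /=; have := uy t.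
  have : t.+1%:R^-1 <= 1 :> R by rewrite invf_le1 ?ler1n ?ltr0n.
  by move: (t.+1%:R^-1) => e; rewrite ltr_norml; lra.
have zy : z = y.
  have [//|] := eqVneq z y; rewrite -subr_eq0 -normr_gt0 => e0.
  set e := `|_| in e0; have e2 : 0 < e / 2 by lra.
  have [t [/= ut]] := filter_ex (filterI (uz _ e2) (Uoo (Num.truncn (e / 2)^-1))).
  move=> Nt; have := uy t; have : t.+1%:R^-1 <= e / 2.
    rewrite -(invrK (e / 2)) lef_pV2 ?posrE ?invr_gt0 ?ltr0n //.
    by rewrite ltW // (lt_le_trans (truncnS_gt _)) // ler_nat.
  move: (t.+1%:R^-1) => f; rewrite ltr_norml => h1 h2.
  have : e < e by rewrite {1}/e ltr_norml; lra.
  by rewrite ltxx.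
rewrite zy in uz hz; have U1 := uz _ ltr01.
case: hz => [h|h].
  by have [t [/= /andP[_ ?] ?]] := filter_ex (filterI U1 h); exists t; split=> //; left.
by have [t /= /andP[_ ?]] := filter_ex U1; exists t; split=> //; right.
Qed.

(** A sequence in [A] converging to [inf A] has a term at most [inf A], since defects converge only
    from below; hence the infimum is attained. *)
Lemma defect_set_min (A : set R) : A `<=` D -> A !=set0 ->
  exists m, A m /\ forall x, A x -> m <= x.
Proof.
move=> AD A0; have infA : has_inf A.
  by split=> //; exists 0 => x /AD/defect_set_ge0.
have infP x : A x -> inf A <= x by move=> Ax; apply: ge_inf => //; exact: infA.2.
have [Am|nAm] := pselect (A (inf A)); first by exists (inf A).
have /choice[u uP] : forall t, exists n, [/\ (0 < n)%N, A (d n)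
    & d n < inf A + t.+1%:R^-1].
  move=> t; have e0 : 0 < t.+1%:R^-1 :> R by rewrite invr_gt0 ltr0n.
  have [x Ax xt] := inf_adherent e0 infA.
  by have [n n0 nx] := AD _ Ax; exists n; rewrite nx.
have [|t|t [ut _]] := defect_seq_limit u (inf A).
- by move=> t; case: (uP t).
- by have [_ /infP] := uP t; move: (t.+1%:R^-1) => e ? ?; rewrite ltr_norml; lra.
have [_ Au _] := uP t; case: nAm.
by rewrite (_ : inf A = d (u t)) //; apply/le_anti; rewrite ut infP.
Qed.

Lemma defect_set_ind (P : R -> Prop) :
  (forall x, D x -> (forall y, D y -> y < x -> P y) -> P x) ->
  forall x, D x -> P x.
Proof.
move=> IH x Dx; apply: contrapT => nPx.
have [||m [[Dm nPm] mP]] := defect_set_min [set y | D y /\ ~ P y].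
- by move=> y [].
- by exists x.
apply: nPm; apply: IH => // y Dy ym; apply: contrapT => nPy.
by have := mP y (conj Dy nPy); rewrite leNgt ym.
Qed.

Lemma defect_exp3M (k n : nat) : (0 < n)%N ->
  d (3 ^ k * n) = d n + (complexity (3 ^ k * n))%:R - (complexity n)%:R - (3 * k)%:R.
Proof.
move=> n0; rewrite /defect natrM natrX lnM ?posrE ?exprn_gt0 ?ltr0n // lnXn //.
rewrite -[ln 3 *+ k]mulr_natl natrM.
by field; rewrite gt_eqF // ln3_gt0.
Qed.

(* The numbers [3 ^ k * n + 1] have defects approaching [d n + 1 - j] for some
   natural [j].  If [j] is positive, smaller limit points lead back up to
   [d n + 1] in unit steps. *)
Lemma limit_point_1D (x : R) : D x -> limit_point (1 + x).
Proof.
move: x; apply: defect_set_ind => _ [n n0 <-] IH; set x := d n in IH *.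
(* A limit point at most [x] is approached by defects strictly below [x], to which induction
   applies. *)
have IHlim y : y <= x -> limit_point y -> limit_point (1 + y).
  move=> yx yl e e0; have e2 : 0 < e / 2 by lra.
  have [z [Dz zy]] := yl _ e2; have [|w [Dw wz]] := IH z Dz _ _ e2; first by lra.
  by exists w; split=> //; lra.
pose m k := (3 ^ k * n + 1)%N.
have n3 k : (0 < 3 ^ k * n)%N by rewrite muln_gt0 expn_gt0.
have mc k : (complexity (m k) <= 3 * k + complexity n + 1)%N.
  apply: leq_trans (complexityD _ _ (n3 k) _) _ => //.
  by rewrite complexity1 leq_add2r complexity_exp3M.
(* The ones saved over the obvious expression of [m k]. Nonnegativity of the defect bounds them, so
   they are constant along an ultrafilter. *)
pose j k := (3 * k + complexity n + 1 - complexity (m k))%N.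
have dm k : d (m k) = x + 1 - (j k)%:R - log3r R (3 ^ k * n) 1.
  rewrite defectD // defect_exp3M // /j natrB // !natrD.
  by rewrite -/(m k) -/x; ring.
have [U [UU Uoo]] := free_ultrafilter_ex.
have [i Ui] : exists i, U [set k | j k = i].
  apply: (@ultra_bounded_const U UU j (Num.truncn (x + 1))).
  apply: filterS (Uoo 0%N) => k _ /=.
  have x0 : 0 <= x by exact: defect_ge0.
  have m0 : 0 <= d (m k) by apply: defect_ge0; rewrite /m addn1.
  rewrite truncn_ge_nat; last by lra.
  by have := log3r_gt0 R _ _ (n3 k) (ltn0Sn 0); move: m0; rewrite dm; lra.
have base : limit_point (x + 1 - i%:R).
  move=> e e0; have [N hN] := log3r_small R 1 _ e0.
  have [k [/= ki Nk]] := filter_ex (filterI Ui (Uoo N)).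
  exists (d (m k)); split; first by exists (m k) => //=; rewrite /m addn1.
  have kn : (N < 3 ^ k * n)%N.
    apply: leq_trans (_ : 3 ^ k <= _)%N; last by rewrite leq_pmulr.
    by apply: leq_ltn_trans Nk _; exact: ltn_expl.
  have := hN _ kn; have := log3r_gt0 R _ _ (n3 k) (ltn0Sn 0).
  by rewrite dm ki; lra.
have up l : (l <= i)%N -> limit_point (x + 1 - i%:R + l%:R).
  elim: l => [|l IHl] li; first by rewrite addr0.
  have -> : x + 1 - i%:R + l.+1%:R = 1 + (x + 1 - i%:R + l%:R) by rewrite -natr1; ring.
  apply: IHlim; last by apply: IHl; exact: ltnW.
  by move: li; rewrite -(ler_nat R) -natr1; lra.
by have := up i (leqnn i); rewrite subrK addrC.
Qed.

Lemma limit_point_adherent (y : R) : limit_point y -> adherent y.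
Proof.
by move=> yl e /yl[x [Dx xy]]; exists x; split=> //; lra.
Qed.

Lemma adherent_1D (y : R) : adherent y -> limit_point (1 + y).
Proof.
move=> ya e e0; have e2 : 0 < e / 2 by lra.
have [z [Dz zy]] := ya _ e2; have [w [Dw wz]] := limit_point_1D _ Dz _ e2.
by exists w; split=> //; lra.
Qed.

Lemma semigroup_closure_adherent (y : R) : semigroup_closure R y -> adherent y.
Proof.
move=> yX e e0; have e2 : 0 < e / 2 by lra.
have [n [j [n0 nj]]] := yX _ e2.
have nja : adherent (d n + j%:R).
  elim: j {nj} => [|j IH].
    by move=> f f0; exists (d n); split; [exists n|lra].
  have -> : d n + j.+1%:R = 1 + (d n + j%:R) by rewrite -natr1; ring.
  by apply: limit_point_adherent; exact: adherent_1D.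
by have [w [Dw wn]] := nja _ e2; exists w; split=> //; lra.
Qed.

(** A sequence strictly below [y] never attains its limit, which leaves the semigroup
    alternative. *)
Lemma limit_point_B1 (y : R) : limit_point y -> adherent (y - 1).
Proof.
move=> yl; have /choice[u uP] : forall t, exists n,
    (0 < n)%N /\ y - t.+1%:R^-1 < d n < y.
  move=> t; have e0 : 0 < t.+1%:R^-1 :> R by rewrite invr_gt0 ltr0n.
  by have [_ [[n n0 <-] ny]] := yl _ e0; exists n.
have [|t|t [_ [uy|]]] := defect_seq_limit u y.
- by move=> t; case: (uP t).
- by have [_] := uP t; move: (t.+1%:R^-1) => e ?; rewrite ltr_norml; lra.
- by have [_] := uP t; rewrite uy ltxx andbF.
- exact: semigroup_closure_adherent.
Qed.

End DefectSet.

(** * Fibres between consecutive limit points *)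

Section OrderType.
Context (R : realType).
Local Notation D := (defect_set R).

Definition least (A : set R) : R := xget 0 [set m | A m /\ forall x, A x -> m <= x].

Lemma leastP (A : set R) : A `<=` D -> A !=set0 ->
  A (least A) /\ forall x, A x -> least A <= x.
Proof.
by move=> AD A0; exact: (@xgetPex _ 0 [set m | A m /\ _]) (defect_set_min R A AD A0).
Qed.

Definition isolated : set R := [set x | D x /\ ~ limit_point R x].

Lemma isolated_sub : isolated `<=` D.
Proof. by move=> x []. Qed.

Lemma isolated0 : isolated 0.
Proof.
split; first exact: defect_set0.
by move=> /(_ _ ltr01)[x [/defect_set_ge0 ? ?]]; lra.
Qed.

Definition next (x : R) : R := least [set y | D y /\ x < y].

Lemma nextP (x : R) : D x ->
  [/\ D (next x), x < next x & forall y, D y -> x < y -> next x <= y].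
Proof.
move=> Dx; have [||[Dn xn] nP] := leastP [set y | D y /\ x < y].
- by move=> y [].
- have [y [Dy xy]] := limit_point_1D R _ Dx _ ltr01.
  by exists y; split=> //; lra.
- by split=> // y Dy xy; exact: nP.
Qed.

Lemma isolated_next (x : R) : D x -> isolated (next x).
Proof.
move=> Dx; have [Dn xn nP] := nextP _ Dx; split=> // nl.
have [|z [Dz zn]] := nl (next x - x); first by lra.
by have := nP z Dz; lra.
Qed.

(** For isolated [t] these are the consecutive blocks, each cofinal below [1 + t], into which [D] is
    cut. *)
Definition fiber (t : R) : set R :=
  [set x | [/\ D x, x < 1 + t & forall s, D s -> s < t -> 1 + s <= x]].

(** A limit point [y] strictly between [x] and [1 + t] would yield an element of [D] above [x - 1]
    and below [t], against the lower bound on [x]. *)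
Lemma fiber_limit_point (t x y : R) :
  fiber t x -> limit_point R y -> x < y -> 1 + t <= y.
Proof.
move=> [Dx xt tP] yl xy; rewrite leNgt; apply/negP => yt.
have [|z [Dz zy]] := limit_point_B1 R _ yl (y - x); first by lra.
by have := tP z Dz; lra.
Qed.

(** As [t] is isolated, smaller defects stay some [e] away from it; any defect between [1 + t - e]
    and [1 + t] is then in the fibre. *)
Lemma fiber_cofinal (t z : R) : isolated t -> z < 1 + t ->
  exists x, fiber t x /\ z < x.
Proof.
move=> [Dt tl] zt.
have [e [e0 eP]] : exists e, 0 < e /\ forall s, D s -> s < t -> s <= t - e.
  apply: contra_notP tl => /forallNP h e e0.
  have /not_andP[//|/existsNP[s /not_implyP[Ds /not_implyP[st /negP]]]] := h e.
  by rewrite -ltNge => ts; exists s; split=> //; lra.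
have f0 : 0 < Num.min e (1 + t - z) by rewrite lt_min e0; lra.
have [x [Dx xt]] := limit_point_1D R _ Dt _ f0.
have [fe fz] : Num.min e (1 + t - z) <= e /\ Num.min e (1 + t - z) <= 1 + t - z.
  by rewrite !ge_min !lexx orbT.
exists x; split; last by lra.
by split=> // [|s Ds /(eP _ Ds)]; lra.
Qed.

Lemma fiber_next (t x : R) : isolated t -> fiber t x -> fiber t (next x).
Proof.
move=> It [Dx xt tP]; have [Dn xn nP] := nextP _ Dx.
have [y [[Dy yt _] xy]] := fiber_cofinal _ _ It xt.
split=> //; first by have := nP y Dy xy; lra.
by move=> s Ds /(tP _ Ds); lra.
Qed.

Lemma fiber_ex (x : R) : D x -> exists t, isolated t /\ fiber t x.
Proof.
move=> Dx; have [||[Dt xt] tP] := leastP [set t | D t /\ x < 1 + t].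
- by move=> y [].
- by exists x; split=> //; lra.
set t := least _ in Dt xt tP; exists t; split; split=> //.
- move=> tl; have [|z [Dz zt]] := tl (1 + t - x); first by lra.
  by have : t <= z by [apply: tP; split=> //; lra]; lra.
- by move=> s Ds st; rewrite leNgt; apply/negP => xs; have := tP s (conj Ds xs); lra.
Qed.

(** * Enumeration of a fibre in order type omega *)

Section Enumeration.
Context (S : set R) (IS : isolated `<=` S) (SD : S `<=` D).

(** [next] is the successor in [D], but its values are isolated and so remain in [S]. Below, [S] is
    [D] at the outermost level and [isolated] for the indices. *)
Definition enum_fiber (t : R) (c : nat) : R := iter c next (least (S `&` fiber t)).

Lemma enum_fiber0 (t : R) : isolated t ->
  (S `&` fiber t) (enum_fiber t 0) /\
  forall x, S x -> fiber t x -> enum_fiber t 0 <= x.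
Proof.
move=> It; have [||h hP] := leastP (S `&` fiber t).
- by move=> x [/SD].
- have [|x [fx _]] := fiber_cofinal _ t It; first by lra.
  have [Dx _ _] := fx; exists (next x); split; last exact: fiber_next.
  by apply: IS; exact: isolated_next.
- by split=> // x Sx fx; exact: hP.
Qed.

Lemma enum_fiberP (t : R) (c : nat) : isolated t -> (S `&` fiber t) (enum_fiber t c).
Proof.
move=> It; elim: c => [|c [Sc fc]]; first by have [] := enum_fiber0 _ It.
split; last exact: fiber_next.
by apply: IS; apply: isolated_next; exact: SD.
Qed.

Lemma enum_fiberS (t : R) (c : nat) : isolated t ->
  enum_fiber t c < enum_fiber t c.+1.
Proof.
by move=> It; have [/SD Dc _] := enum_fiberP _ c It; have [] := nextP _ Dc.
Qed.

Lemma enum_fiber_lt (t : R) (b c : nat) : isolated t -> (b < c)%N ->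
  enum_fiber t b < enum_fiber t c.
Proof.
move=> It; elim: c => [//|c IH]; rewrite ltnS leq_eqVlt => /predU1P[->|bc].
  exact: enum_fiberS.
exact: lt_trans (IH bc) (enum_fiberS _ _ It).
Qed.

(** If [x] were missed, the whole enumeration would stay below it, and its supremum would be a limit
    point inside the fibre. *)
Lemma enum_fiber_surj (t x : R) : isolated t -> S x -> fiber t x ->
  exists c, enum_fiber t c = x.
Proof.
move=> It Sx fx; apply: contrapT => /forallNP nx.
have lt_x c : enum_fiber t c < x.
  rewrite lt_neqAle; apply/andP; split; first by apply/eqP; exact: nx.
  elim: c => [|c IH]; first by have [_] := enum_fiber0 _ It; exact.
  have [/SD Dc _] := enum_fiberP _ c It; have [_ _ nP] := nextP _ Dc.
  apply: nP; first exact: SD.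
  by rewrite lt_neqAle IH andbT; apply/eqP; exact: nx.
pose E : set R := range (enum_fiber t); pose y := sup E.
have supE : has_sup E.
  split; first by exists (enum_fiber t 0), 0%N.
  by exists x => _ [c _ <-]; exact: ltW.
have le_y c : enum_fiber t c < y.
  apply: lt_le_trans (enum_fiberS _ _ It) _.
  by apply: ub_le_sup; [exact: supE.2|exists c.+1].
have yx : y <= x by apply: ge_sup; [exact: supE.1|move=> _ [c _ <-]; exact: ltW].
have yl : limit_point R y.
  move=> e e0; have [_ [c _ <-] yc] := sup_adherent e0 supE.
  exists (enum_fiber t c); split; last by rewrite yc le_y.
  by have [/SD] := enum_fiberP _ c It.
have [_ f0] := enum_fiberP _ 0 It.
have := fiber_limit_point _ _ _ f0 yl (le_y 0%N).
by case: fx => _; lra.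
Qed.

End Enumeration.

(* [cnf S [:: c0; c1; ...]] is the element of [S] at the ordinal position
   c0 + omega * c1 + omega ^ 2 * c2 + ... *)
Fixpoint cnf (S : set R) (s : seq nat) : R :=
  if s is c :: s' then enum_fiber S (cnf isolated s') c else 0.

Lemma cnf_isolated (s : seq nat) : isolated (cnf isolated s).
Proof.
elim: s => [|c s IH]; first exact: isolated0.
by have [] := enum_fiberP isolated (@subset_refl _ _) isolated_sub _ c IH.
Qed.

Lemma cnf_in (S : set R) (s : seq nat) :
  isolated `<=` S -> S `<=` D -> S (cnf S s).
Proof.
move=> IS SD; case: s => [|c s]; first by apply: IS; exact: isolated0.
by have [] := enum_fiberP S IS SD _ c (cnf_isolated s).
Qed.

Lemma cnf_nseq0 (S : set R) : isolated `<=` S -> S `<=` D -> cnf S [:: 0%N] = 0.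
Proof.
move=> IS SD; have [[/SD/defect_set_ge0 e0 _] eP] := enum_fiber0 S IS SD _ isolated0.
apply/le_anti; rewrite e0 andbT; apply: eP; first exact: IS isolated0.
split; [exact: defect_set0|lra|].
by move=> z /defect_set_ge0; lra.
Qed.

(** Leading zero coefficients are harmless because 0 is the first element of the fibre over 0. *)
Lemma cnf_rcons0 (S : set R) (s : seq nat) :
  isolated `<=` S -> S `<=` D -> cnf S (rcons s 0%N) = cnf S s.
Proof.
elim: s S => [|c s IH] S IS SD; first exact: cnf_nseq0.
by rewrite rcons_cons /= IH //; exact: isolated_sub.
Qed.

(** Different tails give different indices, and [1 +] the smaller index separates the two fibres;
    with equal tails, the first coefficient decides inside one fibre. *)
Lemma cnf_lt (S : set R) (s t : seq nat) (b : nat) :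
  isolated `<=` S -> S `<=` D -> size s = size t ->
  (nth 0 s b < nth 0 t b)%N ->
  (forall c, (b < c)%N -> nth 0%N s c = nth 0%N t c) -> cnf S s < cnf S t.
Proof.
elim: s t b S => [|c s IH] [|c' t] b S IS SD //=; first by rewrite !nth_nil.
move=> [st] lt eq; case: b lt eq => [|b] /= lt eq.
  have -> : s = t by apply: (@eq_from_nth _ 0%N) => // i _; exact: (eq i.+1).
  by apply: enum_fiber_lt => //; exact: cnf_isolated.
have st_lt : cnf isolated s < cnf isolated t.
  apply: (IH _ b) => //; first exact: isolated_sub.
  by move=> i bi; exact: (eq i.+1).
have Is := cnf_isolated s; have It := cnf_isolated t.
have [_ [_ sc _]] := enum_fiberP S IS SD _ c Is.
have [_ [_ _ tc]] := enum_fiberP S IS SD _ c' It.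
exact: lt_le_trans sc (tc _ (isolated_sub _ Is) st_lt).
Qed.

Lemma cnf_lt_size (S : set R) (c : nat) (s : seq nat) :
  isolated `<=` S -> S `<=` D -> cnf S (c :: s) < (size s).+1%:R.
Proof.
elim: s c S => [|i s IH] c S IS SD.
  have [_ [_ h _]] := enum_fiberP S IS SD _ c isolated0.
  by rewrite addr0 in h.
have [_ [_ h _]] := enum_fiberP S IS SD _ c (cnf_isolated (i :: s)).
apply: lt_trans h _; rewrite -natr1 addrC ltrD2r.
by apply: IH => //; exact: isolated_sub.
Qed.

Lemma limit_point_nat (k : nat) : limit_point R k.+1%:R.
Proof.
elim: k => [|k IH].
  by rewrite -(addr0 1%:R); apply: limit_point_1D; exact: defect_set0.
by rewrite -natr1 addrC; apply: adherent_1D; exact: limit_point_adherent.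
Qed.

Lemma cnf_surj (S : set R) (k : nat) (x : R) :
  isolated `<=` S -> S `<=` D -> S x -> x < k.+1%:R ->
  exists s, size s = k.+1 /\ cnf S s = x.
Proof.
elim: k S x => [|k IH] S x IS SD Sx xk; have [t [It fx]] := fiber_ex _ (SD _ Sx);
  have [c cx] := enum_fiber_surj S IS SD _ _ It Sx fx; have [Dx xt tP] := fx.
  exists [:: c]; split=> //=; rewrite -cx; congr (enum_fiber _ _ _).
  apply/le_anti; rewrite defect_set_ge0 /=; last exact: isolated_sub.
  by rewrite leNgt; apply/negP => t0; have := tP _ (defect_set0 R) t0; lra.
(* Otherwise the limit point [k + 1] would be approached by some [z < t] in [D] with [x < 1 + z]. *)
have tk : t < k.+1%:R.
  rewrite ltNge; apply/negP => kt.
  have [|z [Dz zk]] := limit_point_nat k (k.+1%:R - (x - 1)).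
    by move: xk; rewrite -natr1; lra.
  by have := tP z Dz; lra.
have [s [sk st]] := IH _ _ (@subset_refl _ _) isolated_sub It tk.
by exists (c :: s); rewrite /= sk st.
Qed.

(** * Order types *)

Definition revlex (f g : nat -> nat) : Prop :=
  exists b, (f b < g b)%N /\ forall c, (b < c)%N -> f c = g c.

Lemma revlex_total (f g : nat -> nat) (K : nat) :
  (forall i, (K <= i)%N -> f i = g i) -> [\/ f =1 g, revlex f g | revlex g f].
Proof.
elim: K => [|K IH] fg; first by constructor 1 => i; exact: fg.
have [E|lt|lt] := ltngtP (f K) (g K).
- by constructor 2; exists K.
- by constructor 3; exists K; split=> // c Kc; rewrite fg.
- apply: IH => i; rewrite leq_eqVlt => /predU1P[<-//|]; exact: fg.
Qed.

Lemma cnf_mkseq (f : nat -> nat) (K L : nat) : (K <= L)%N ->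
  (forall i, (K <= i)%N -> f i = 0%N) -> cnf D (mkseq f L) = cnf D (mkseq f K).
Proof.
move=> KL f0; elim: L KL => [|L IH]; first by rewrite leqn0 => /eqP ->.
rewrite leq_eqVlt => /predU1P[->//|KL].
by rewrite mkseqS f0 // cnf_rcons0 ?IH //; exact: isolated_sub.
Qed.

Lemma cnf_revlex (f g : nat -> nat) (K L : nat) : revlex f g ->
  (forall i, (K <= i)%N -> f i = 0%N) -> (forall i, (L <= i)%N -> g i = 0%N) ->
  cnf D (mkseq f K) < cnf D (mkseq g L).
Proof.
move=> [b [lt eq]] f0 g0; set M := maxn K L.
rewrite -(@cnf_mkseq f K M) ?leq_maxl // -(@cnf_mkseq g L M) ?leq_maxr //.
have bM : (b < M)%N.
  rewrite ltnNge; apply/negP => Mb; move: lt.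
  by rewrite g0 // (leq_trans _ Mb) // leq_maxr.
apply: (@cnf_lt _ _ _ b isolated_sub) => //; first by rewrite !size_mkseq.
  by rewrite !nth_mkseq.
move=> c bc; have [cM|Mc] := ltnP c M; first by rewrite !nth_mkseq // eq.
by rewrite !nth_default // size_mkseq.
Qed.

(** Serves both order types: [ext] reads an element of [W] as a coefficient sequence that vanishes
    from [K] on. Totality of [revlex] turns strict monotonicity into injectivity and reflection of
    the order. *)
Lemma has_order_type_cnf (A : set R) (W : Type) (ltW : W -> W -> Prop)
    (ext : W -> nat -> nat) (K : W -> nat) :
  (forall w i, (K w <= i)%N -> ext w i = 0%N) ->
  (forall u v, ext u =1 ext v -> u = v) ->
  (forall u v, ltW u v <-> revlex (ext u) (ext v)) ->
  (forall w, A (cnf D (mkseq (ext w) (K w)))) ->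
  (forall x, A x -> exists w, cnf D (mkseq (ext w) (K w)) = x) ->
  has_order_type A ltW.
Proof.
move=> K0 inj ltE hA surj; pose h w := cnf D (mkseq (ext w) (K w)).
have lt_h u v : revlex (ext u) (ext v) -> h u < h v.
  by move=> uv; apply: cnf_revlex => //; exact: K0.
have total u v : [\/ u = v, revlex (ext u) (ext v) | revlex (ext v) (ext u)].
  have [i|uv|uv|uv] := @revlex_total (ext u) (ext v) (maxn (K u) (K v)).
  - by rewrite geq_max => /andP[ui vi]; rewrite !K0.
  - by constructor 1; exact: inj.
  - by constructor 2.
  - by constructor 3.
exists h; split; first split.
- by move=> w _; exact: hA.
- by move=> u v _ _ uv; have [//|/lt_h|/lt_h] := total u v; rewrite uv ltxx.
- by move=> x /surj[w wx]; exists w.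
- move=> u v; rewrite ltE; split; first exact: lt_h.
  move=> uv; have [E|//|/lt_h vu] := total u v.
    by rewrite E ltxx in uv.
  by have := lt_trans uv vu; rewrite ltxx.
Qed.

Lemma defect_set_omega_omega : has_order_type D (@omega_pow_lt _ nat).
Proof.
pose K (f : omega_pow nat) := (\max_(i <- finsupp f) i.+1)%N.
have K0 (f : omega_pow nat) i : (K f <= i)%N -> f i = 0%N.
  move=> Ki; apply: fsfun_dflt; apply/negP => fi.
  by have := @leq_bigmax_seq _ _ xpredT S i fi isT; rewrite leqNgt ltnS Ki.
apply: (@has_order_type_cnf _ _ _ (fun f : omega_pow nat => (f : nat -> nat)) K) => //.
- by move=> u v /fsfunP.
- by move=> f; apply: cnf_in => //; exact: isolated_sub.
- move=> x Dx; have xk := truncnS_gt x.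
  have [s [_ sx]] := cnf_surj _ _ _ isolated_sub (@subset_refl _ _) Dx xk.
  pose f : omega_pow nat :=
    [fsfun i in [fset i | i in iota 0 (size s)]%fset => nth 0%N s i | 0%N].
  have fE i : f i = nth 0%N s i.
    rewrite fsfun_fun; case: ifPn => //; rewrite in_fset /= mem_iota /= add0n -leqNgt.
    by move=> /(nth_default 0%N) ->.
  exists f; rewrite -sx.
  have -> : s = mkseq f (size s) by rewrite (eq_mkseq fE) mkseq_nth.
  rewrite -(@cnf_mkseq f _ (maxn (K f) (size s))) ?leq_maxl //; last exact: K0.
  rewrite (@cnf_mkseq f (size s) (maxn _ _)) ?leq_maxr //.
  by move=> i si; rewrite fE nth_default.
Qed.

Lemma defect_set_omega_pow (k : nat) : (1 <= k)%N ->
  has_order_type (D `&` `[0, k%:R[) (@omega_pow_lt _ 'I_k).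
Proof.
case: k => [//|k] _.
pose ext (f : omega_pow 'I_k.+1) i := if insub i is Some j then f j else 0%N.
have extE f (j : 'I_k.+1) : ext f j = f j by rewrite /ext valK.
apply: (@has_order_type_cnf _ _ _ ext (fun=> k.+1)).
- by move=> w i ki; rewrite /ext insubF // ltnNge ki.
- by move=> u v uv; apply/fsfunP => j; rewrite -!extE.
- move=> u v; split=> [[b [lt eq]]|[b [lt eq]]].
    exists b; rewrite !extE; split=> // c bc; rewrite /ext.
    by case: insubP => // j _ jc; apply: eq; rewrite ltEord jc.
  have bk : (b < k.+1)%N.
    by move: lt; rewrite /ext; case: insubP => //; rewrite ltnn.
  exists (Ordinal bk); split; first by rewrite -!extE.
  by move=> c bc; rewrite -!extE; apply: eq; rewrite ltEord in bc.
- move=> w; have Dw := cnf_in _ (mkseq (ext w) k.+1) isolated_sub (@subset_refl _ _).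
  split=> //; rewrite /= in_itv /= defect_set_ge0 //=.
  have := cnf_lt_size D (ext w 0%N) (map (ext w) (iota 1 k)) isolated_sub.
  by move=> /(_ (@subset_refl _ _)); rewrite size_map size_iota.
- move=> x [Dx xI]; have xk : x < k.+1%:R by move: xI; rewrite /= in_itv => /andP[].
  have [s [sk sx]] := cnf_surj _ _ _ isolated_sub (@subset_refl _ _) Dx xk.
  exists [fsfun i in [fset i | i in 'I_k.+1]%fset => nth 0%N s i | 0%N]; rewrite -sx; apply: (congr1 (cnf D)).
  apply: (@eq_from_nth _ 0%N); first by rewrite size_mkseq sk.
  rewrite size_mkseq => i ik; rewrite nth_mkseq //.
  by rewrite -[i]/(val (Ordinal ik)) extE fsfun_fun in_fset.
Qed.

End OrderType.

Theorem theorem1p2 (R : realType) :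
  [/\ defect_set R `<=` `[0, +oo[,
      wo_chain <=%R (mem (defect_set R)),
      has_order_type (defect_set R) (@omega_pow_lt _ nat)
    & forall k : nat, (1 <= k)%N ->
        has_order_type (defect_set R `&` `[0, k%:R[)
                       (@omega_pow_lt _ 'I_k)].
Proof.
split.
- by move=> x /defect_set_ge0 x0; rewrite /= in_itv /= x0.
- move=> A AD [x Ax].
  have [||m [Am mP]] := @defect_set_min R [set y | y \in A].
  + by move=> y yA; have := AD y yA; rewrite inE.
  + by exists x.
  exists m; split; first by split.
  by move=> y [yA yP]; apply/le_anti; rewrite mP //= yP.
- exact: defect_set_omega_omega.
- exact: defect_set_omega_pow.
Qed.
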